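(* Let $A\in\mathbb{R}^{Nn\times Nn}$ be a symmetric block tridiagonal matrix with diagonal blocks $b_k\in\mathbb{R}^{n\times n}$ ($k=1,\dots,N$), blocks $c_k\in\mathbb{R}^{n\times n}$ in block position $(k,k-1)$ and $c_k^{\mathrm T}$ in block position $(k-1,k)$ ($k=2,\dots,N$), and all other blocks zero. Suppose $\alpha_L,\alpha_U$ are real numbers with $$0<\alpha_L\le\lambda_{\min}(A)\le\lambda_{\max}(A)\le\alpha_U.$$ Define the forward block tridiagonal (FBT) iteration by $d_1^f=b_1$ and $$d_k^f=b_k-c_k(d_{k-1}^f)^{-1}c_k^{\mathrm T},\qquad k=2,\dots,N.$$ Then $$0<\alpha_L\le\lambda_{\min}(d_k^f)\le\lambda_{\max}(d_k^f)\le\alpha_U\qquad\text{for all }k=1,\dots,N.$$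
   Context: $\lambda_{\min},\lambda_{\max}$ denote the minimum and maximum eigenvalues of a symmetric matrix. *)

(* Defs.v *)
From mathcomp Require Import all_boot all_order all_algebra.
From mathcomp Require Import classical_sets reals.

Set Implicit Arguments.
Unset Strict Implicit.
Unset Printing Implicit Defensive.

Import Order.TTheory GRing.Theory Num.Theory.
Local Open Scope ring_scope.
Local Open Scope classical_set_scope.

Section Eigenvalues.
Context {R : realType} {m : nat}.
Implicit Types (M : 'M[R]_m) (a l : R).

Definition is_min_eigenvalue M l : Prop :=
  eigenvalue M l /\ (forall a, eigenvalue M a -> l <= a).

Definition is_max_eigenvalue M l : Prop :=
  eigenvalue M l /\ (forall a, eigenvalue M a -> a <= l).

(* The value 0 is junk, taken only when M has no real eigenvalue; a symmetric
   matrix of positive size has finitely many eigenvalues, and at least one. *)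
Definition lambda_min M : R := xget 0 [set l | is_min_eigenvalue M l].

Definition lambda_max M : R := xget 0 [set l | is_max_eigenvalue M l].

End Eigenvalues.

Section BlockTridiagonal.
Context {R : realType} {n : nat}.

(* Block indices start at 0: the k-th diagonal block of the mathematical text
   (k = 1, ..., N) is b k.-1, and its k-th subdiagonal block, in block position
   (k, k - 1) for k = 2, ..., N, is c k.-1. In particular c 0 is never used. *)
Implicit Types b c : nat -> 'M[R]_n.

Definition tridiag_block b c (i j : nat) : 'M[R]_n :=
  if i == j then b i
  else if i == j.+1 then c i
  else if j == i.+1 then (c j)^T
  else 0.

(* The size \sum_(i < N) n, equal to N * n, is the one carried by \mxblock. *)
Definition block_tridiag (N : nat) b c : 'M[R]_(\sum_(i < N) n) :=
  \mxblock_(i < N, j < N) tridiag_block b c i j.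

(* invmx M is M itself when M is singular. *)
Fixpoint fbt b c (k : nat) : 'M[R]_n :=
  match k with
  | 0 => b 0
  | k'.+1 => b k'.+1 - c k'.+1 *m invmx (fbt b c k') *m (c k'.+1)^T
  end.

End BlockTridiagonal.

(* Main.v *)
Require Import Defs.
From mathcomp Require Import all_boot all_order all_algebra.
From mathcomp Require Import classical_sets reals.
From mathcomp Require Import complex.

Import Order.TTheory GRing.Theory Num.Theory.
Local Open Scope ring_scope.

(** Bounds on the eigenvalues of a symmetric matrix M of positive size are
    bounds on its quadratic form: l <= lambda_min M and lambda_max M <= u hold
    exactly when l |x|^2 <= x M x^T <= u |x|^2 for every row vector x. This follows from
    the spectral theorem ([symmetric_diagonalization], [qform_ge_lambda_min],
    [qform_le_lambda_max], [lambda_bounds]), so it suffices to carry the two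
    inequalities from A over to the matrices d_k of the recursion.

    Lower bound. The matrix d_k is the Schur complement of its leading blocks
    in the leading part of A. Concretely, given a block v, block elimination
    ([block_elimination]) yields a block vector x whose k-th block is v, whose
    later blocks vanish, and such that x A has zero blocks before position k
    and the block v d_k at position k. Hence v d_k v^T = x A x^T, and
    x A x^T >= l |x|^2 >= l |v|^2 ([qform_fbt_ge]). The elimination needs
    d_0, ..., d_(k-1) to be invertible, which the lower bound itself provides
    by induction ([fbt_coercive]).

    Upper bound. Since d_(k-1) is positive definite, so is its inverse, and
    v d_k v^T = v b_k v^T - (v c_k) d_(k-1)^-1 (v c_k)^T <= v b_k v^T. The
    right-hand side is the quadratic form of A at the block vector that has v
    as its only nonzero block, hence is at most u |v|^2 ([qform_fbt_le]). *)

(** * Extremal eigenvalues of a symmetric matrix and its quadratic form *)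

Section Spectral.
Local Notation "M ^t*" := (map_mx Num.conj M^T) (at level 30).

(** Real symmetric matrices are Hermitian over the complex numbers, so the
    spectral theorem for normal matrices applies: w lists the squared moduli
    of the complex coordinates of x in a unitary eigenbasis. Only these
    weights are kept, since they are real and both forms are linear in them;
    this avoids the construction of a real eigenbasis. *)
Lemma symmetric_diagonalization (R : rcfType) m (M : 'M[R]_m) : M^T = M ->
  exists2 s : 'I_m -> R, (forall i, eigenvalue M (s i)) &
  forall x : 'rV_m, exists w : 'I_m -> R,
    [/\ forall i, 0 <= w i, (x *m x^T) 0 0 = \sum_i w i
      & (x *m M *m x^T) 0 0 = \sum_i s i * w i].
Proof.
move=> Msym; pose toC : {rmorphism R -> complex R} := real_complex R.
have toC_real (a : R) : toC a \is Num.real by apply/complex_realP; exists a.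
pose Mc := map_mx toC M.
have Mc_herm : Mc \is hermsymmx.
  apply: realsym_hermsym; last by apply/mxOverP => i j; rewrite mxE.
  by apply/is_hermitianmxP; rewrite expr0 scale1r map_mx_id// map_trmx Msym.
have /mxOverP D_real := hermitian_spectral_diag_real Mc_herm.
have /orthomx_spectralP := hermitian_normalmx Mc_herm.
set P := spectralmx Mc in D_real *.
set D := spectral_diag Mc in D_real * => McE.
have P_unit : P \in unitmx := spectral_unit Mc.
have P_unitary : P \is unitarymx := spectral_unitarymx Mc.
pose s i := complex.Re (D 0 i).
have sE i : toC (s i) = D 0 i by apply: RRe_real.
exists s => [i|x].
  (* Being an eigenvalue is a statement about the characteristic polynomial,
     so it can be checked over the complex numbers, where row i of P is an
     eigenvector. *)
  rewrite eigenvalue_root_char -(fmorph_root toC) map_char_poly.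
  rewrite -eigenvalue_root_char.
  apply/eigenvalueP; exists (row i P).
    rewrite -row_mul -/Mc {1}McE !mulmxA mulmxV// mul1mx row_mul.
    by rewrite row_diag_mx -scalemxAl -rowE -sE.
  apply: contraTneq P_unit => Pi0; rewrite -row_free_unit.
  by apply/row_freePn; exists i; rewrite Pi0 sub0mx.
pose xc := map_mx toC x; pose y := xc *m invmx P.
have xcE : xc = y *m P by rewrite mulmxKV.
have xcT : map_mx toC x^T = invmx P *m y ^t*.
  rewrite invmx_unitary// -map_mxM -trmx_mul -xcE.
  by apply/matrixP => i j; rewrite !mxE; apply/esym/conj_Creal.
pose w i := complex.Re (y 0 i * (y 0 i)^*).
have wE i : toC (w i) = y 0 i * (y 0 i)^*
  by apply: RRe_real; rewrite ger0_real// mul_conjC_ge0.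
exists w; split => [i||].
- by rewrite -lecR [leRHS]wE mul_conjC_ge0.
- apply: (fmorph_inj toC); rewrite rmorph_sum/=.
  transitivity ((xc *m map_mx toC x^T) 0 0); first by rewrite -map_mxM [RHS]mxE.
  rewrite xcT {1}xcE mulmxA mulmxK// mxE; apply: eq_bigr => i _.
  by rewrite wE !mxE.
apply: (fmorph_inj toC); rewrite rmorph_sum/=.
transitivity ((xc *m Mc *m map_mx toC x^T) 0 0).
  by rewrite -!map_mxM [RHS]mxE.
rewrite xcT McE xcE !mulmxA !mulmxK// mxE; apply: eq_bigr => i _.
by rewrite rmorphM/= wE sE mul_mx_diag !mxE mulrAC mulrC.
Qed.

End Spectral.

Local Notation sqnorm x := ((x *m x^T) 0 0).
Local Notation qform M x := ((x *m M *m x^T) 0 0).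

Section ExtremalEigenvalues.
Context {R : realType}.

Lemma sqnorm_ge0 m (x : 'rV[R]_m) : 0 <= sqnorm x.
Proof.
by rewrite mxE sumr_ge0// => i _; rewrite mxE -expr2 sqr_ge0.
Qed.

Lemma sqnorm_eq0 m (x : 'rV[R]_m) : (sqnorm x == 0) = (x == 0).
Proof.
apply/idP/eqP => [|->]; last by rewrite mul0mx mxE.
rewrite mxE psumr_eq0 => [/allP x0|i _]; last by rewrite mxE -expr2 sqr_ge0.
apply/rowP => i; have := x0 i (mem_index_enum i).
by rewrite !mxE -expr2 sqrf_eq0 => /eqP.
Qed.

Lemma sqnorm_gt0 m (x : 'rV[R]_m) : (0 < sqnorm x) = (x != 0).
Proof. by rewrite lt_def sqnorm_ge0 andbT sqnorm_eq0. Qed.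

Lemma qform_eigenvector m (M : 'M[R]_m) a (v : 'rV_m) :
  v *m M = a *: v -> qform M v = a * sqnorm v.
Proof. by move=> vM; rewrite vM -scalemxAl mxE. Qed.

Lemma eigenvalue_ge m (M : 'M[R]_m) l a :
  (forall x : 'rV_m, l * sqnorm x <= qform M x) -> eigenvalue M a -> l <= a.
Proof.
move=> lM /eigenvalueP[v vM v_neq0].
by have := lM v; rewrite (qform_eigenvector _ _ _ _ vM) ler_pM2r ?sqnorm_gt0.
Qed.

Lemma eigenvalue_le m (M : 'M[R]_m) u a :
  (forall x : 'rV_m, qform M x <= u * sqnorm x) -> eigenvalue M a -> a <= u.
Proof.
move=> Mu /eigenvalueP[v vM v_neq0].
by have := Mu v; rewrite (qform_eigenvector _ _ _ _ vM) ler_pM2r ?sqnorm_gt0.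
Qed.

Section Symmetric.
Variables (m : nat) (M : 'M[R]_m).
Hypotheses (m_gt0 : (0 < m)%N) (M_sym : M^T = M).

(** The smallest of the diagonal entries s i is the least eigenvalue: it
    bounds the quadratic form from below, hence every eigenvalue. *)
Lemma lambda_minP : is_min_eigenvalue M (lambda_min M).
Proof.
apply: xgetPex; have [s s_eig sM] := symmetric_diagonalization _ _ _ M_sym.
case: (arg_minP s (erefl : predT (Ordinal m_gt0))) => i _ s_min.
exists (s i); split=> // a; apply: eigenvalue_ge => x.
have [w [w_ge0 -> ->]] := sM x; rewrite mulr_sumr.
by apply: ler_sum => j _; rewrite ler_wpM2r ?s_min.
Qed.

Lemma lambda_maxP : is_max_eigenvalue M (lambda_max M).
Proof.
apply: xgetPex; have [s s_eig sM] := symmetric_diagonalization _ _ _ M_sym.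
case: (arg_maxP s (erefl : predT (Ordinal m_gt0))) => i _ s_max.
exists (s i); split=> // a; apply: eigenvalue_le => x.
have [w [w_ge0 -> ->]] := sM x; rewrite mulr_sumr.
by apply: ler_sum => j _; apply: ler_wpM2r => //; apply: s_max.
Qed.

Lemma qform_ge_lambda_min (x : 'rV_m) : lambda_min M * sqnorm x <= qform M x.
Proof.
have [s s_eig /(_ x)[w [w_ge0 -> ->]]] := symmetric_diagonalization _ _ _ M_sym.
have [_ le_eig] := lambda_minP; rewrite mulr_sumr.
by apply: ler_sum => j _; rewrite ler_wpM2r ?le_eig.
Qed.

Lemma qform_le_lambda_max (x : 'rV_m) : qform M x <= lambda_max M * sqnorm x.
Proof.
have [s s_eig /(_ x)[w [w_ge0 -> ->]]] := symmetric_diagonalization _ _ _ M_sym.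
have [_ eig_le] := lambda_maxP; rewrite mulr_sumr.
by apply: ler_sum => j _; rewrite ler_wpM2r ?eig_le.
Qed.

(** The converse of the previous two lemmas: evaluate the quadratic form at
    eigenvectors. *)
Lemma lambda_bounds l u :
    (forall x : 'rV_m, l * sqnorm x <= qform M x) ->
    (forall x : 'rV_m, qform M x <= u * sqnorm x) ->
  [/\ l <= lambda_min M, lambda_min M <= lambda_max M & lambda_max M <= u].
Proof.
move=> lM Mu; have [min_eig le_eig] := lambda_minP.
have [max_eig _] := lambda_maxP.
by split; [apply: eigenvalue_ge min_eig | apply: le_eig
  | apply: eigenvalue_le max_eig].
Qed.

End Symmetric.

Lemma unitmx_coercive m (M : 'M[R]_m) l :
  0 < l -> (forall x : 'rV_m, l * sqnorm x <= qform M x) -> M \in unitmx.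
Proof.
move=> l_gt0 lM; rewrite -row_free_unit; apply: inj_row_free => v vM0.
apply/eqP; rewrite -sqnorm_eq0 eq_le sqnorm_ge0 andbT.
by rewrite -(pmulr_rle0 _ l_gt0) (le_trans (lM v))// vM0 mul0mx mxE.
Qed.

(** Substituting y = x M^-1 turns the form of M into the form of its
    inverse. *)
Lemma qform_invmx_ge0 m (M : 'M[R]_m) (x : 'rV_m) : M^T = M -> M \in unitmx ->
  (forall y : 'rV_m, 0 <= qform M y) -> 0 <= qform (invmx M) x.
Proof.
move=> M_sym M_unit M_ge0; have := M_ge0 (x *m invmx M).
by rewrite mulmxKV// trmx_mul trmx_inv M_sym mulmxA.
Qed.

End ExtremalEigenvalues.

(** * Block elimination in a block tridiagonal matrix *)

Section BlockElimination.
Context {R : realType} {n : nat}.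
Implicit Types (b c : nat -> 'M[R]_n) (v : 'rV[R]_n) (x : nat -> 'rV[R]_n).

(** The blocks of a vector are indexed by nat, as are b and c, so that N does
    not interfere with inductions on the block index. *)
Definition blockv (N : nat) x : 'rV[R]_(\sum_(i < N) n) := \mxrow_(i < N) x i.

Definition blockv1 k v : nat -> 'rV[R]_n := fun i => if i == k then v else 0.

Lemma sqnorm_blockv N x : sqnorm (blockv N x) = \sum_(i < N) sqnorm (x i).
Proof. by rewrite tr_mxrow mul_mxrow_mxcol summxE. Qed.

Lemma qform_blockv N b c x :
  qform (block_tridiag N b c) (blockv N x) =
  \sum_(j < N) ((\sum_(i < N) x i *m tridiag_block b c i j) *m (x j)^T) 0 0.
Proof. by rewrite mul_mxrow_mxblock tr_mxrow mul_mxrow_mxcol summxE. Qed.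

Lemma sum_blockv1 N b c k v j : (k < N)%N ->
  \sum_(i < N) blockv1 k v i *m tridiag_block b c i j =
  v *m tridiag_block b c k j.
Proof.
move=> ltkN; rewrite (bigD1 (Ordinal ltkN))//= big1 => [|i i_neqk].
  by rewrite addr0 /blockv1 eqxx.
by rewrite [blockv1 k v i]ifN ?mul0mx.
Qed.

(** Back substitution: x is obtained from x_k = v by
    x_(j-1) = - x_j c_j d_(j-1)^-1. In the inductive step the contribution
    v c_(k+1) of the new block at position k cancels against the block
    w d_k = - v c_(k+1) produced by the vector that ends in w at position k,
    while position k+1 receives v b_(k+1) + w c_(k+1)^T = v d_(k+1). The block
    v c_(k+1)^T at position k+1 is needed for the induction; in x A x^T it
    meets the zero block x_(k+1). *)
Lemma block_elimination N b c k v : (k < N)%N ->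
    (forall j, (j < k)%N -> fbt b c j \in unitmx) ->
  exists x, [/\ x k = v, forall j, (k < j)%N -> x j = 0 &
    forall j, \sum_(i < N) x i *m tridiag_block b c i j =
      blockv1 k (v *m fbt b c k) j + blockv1 k.+1 (v *m (c k.+1)^T) j].
Proof.
elim: k v => [|k IHk] v ltkN fbt_unit.
  exists (blockv1 0 v); split=> [//|[]//|j].
  rewrite sum_blockv1// /tridiag_block /blockv1.
  by case: j => [|[|j]]; rewrite /= ?mulmx0 ?addr0 ?add0r.
(* The recursive vector ends in w = - v c_(k+1) d_k^-1. *)
have [] := IHk (- (v *m c k.+1 *m invmx (fbt b c k))) (ltnW ltkN).
  by move=> j ltjk; apply: fbt_unit; apply: ltnW.
move=> x [xk x0 xT]; exists (fun i => blockv1 k.+1 v i + x i).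
split=> [|j ltkj|j].
- by rewrite x0// addr0 /blockv1 eqxx.
- by rewrite x0 1?ltnW// addr0 /blockv1 gtn_eqF.
under eq_bigr do rewrite mulmxDl.
rewrite big_split/= sum_blockv1// xT mulNmx mulmxKV ?fbt_unit//.
rewrite /tridiag_block /blockv1.
case: (ltngtP j k.+1) => [ltjk|ltkj|->].
- rewrite eqSS eq_sym; case: eqP => [->|_].
    by rewrite addr0 subrr ltn_eqF// addr0.
  by rewrite !ltn_eqF ?mulmx0 ?addr0// ltnS ltnW.
- rewrite (gtn_eqF (ltnW ltkj)) ltn_eqF; last by rewrite ltnS ltnW.
  by case: eqP => [->|_]; rewrite ?mulmx0 !addr0 // add0r.
rewrite gtn_eqF// eqn_leq ltnn andbF add0r addr0.
by rewrite mulmxBr mulNmx !mulmxA.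
Qed.

Variables (N : nat) (b c : nat -> 'M[R]_n).
Local Notation A := (block_tridiag N b c).

Lemma diag_block_sym k : A^T = A -> (k < N)%N -> (b k)^T = b k.
Proof.
rewrite /block_tridiag tr_mxblock => /eq_mxblockP A_sym ltkN.
by have := A_sym (Ordinal ltkN) (Ordinal ltkN); rewrite /tridiag_block /= eqxx.
Qed.

Lemma qform_diag_block k v : (k < N)%N ->
  qform A (blockv N (blockv1 k v)) = qform (b k) v.
Proof.
move=> ltkN; rewrite qform_blockv; under eq_bigr do rewrite sum_blockv1//.
rewrite (bigD1 (Ordinal ltkN))//= big1 => [|i i_neqk].
  by rewrite /tridiag_block /blockv1 !eqxx addr0.
by rewrite [blockv1 k v i]ifN ?trmx0 ?mulmx0 ?mxE.
Qed.

Lemma sqnorm_blockv1 k v : (k < N)%N ->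
  sqnorm (blockv N (blockv1 k v)) = sqnorm v.
Proof.
move=> ltkN; rewrite sqnorm_blockv.
rewrite (bigD1 (Ordinal ltkN))//= big1 => [|i i_neqk].
  by rewrite /blockv1 eqxx addr0.
by rewrite [blockv1 k v i]ifN ?mul0mx ?mxE.
Qed.

(** The vector x given by block elimination satisfies x A x^T = v d_k v^T,
    and v is one of its blocks, so that |v| <= |x|. *)
Lemma qform_fbt_ge l k v : 0 <= l ->
    (forall x : 'rV_(\sum_(i < N) n), l * sqnorm x <= qform A x) ->
    (k < N)%N -> (forall j, (j < k)%N -> fbt b c j \in unitmx) ->
  l * sqnorm v <= qform (fbt b c k) v.
Proof.
move=> l_ge0 lA ltkN fbt_unit.
have [x [xk x0 xT]] := block_elimination N b c k v ltkN fbt_unit.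
have <- : qform A (blockv N x) = qform (fbt b c k) v.
  rewrite qform_blockv; under eq_bigr do rewrite xT.
  rewrite (bigD1 (Ordinal ltkN))//= big1 => [|i i_neqk].
    by rewrite xk /blockv1 eqxx ltn_eqF// !addr0.
  rewrite [blockv1 k _ i]ifN// add0r /blockv1.
  case: eqP => [->|_]; last by rewrite mul0mx mxE.
  by rewrite x0// trmx0 mulmx0 mxE.
apply: le_trans _ (lA _); rewrite ler_wpM2l// sqnorm_blockv.
rewrite (bigD1 (Ordinal ltkN))//= xk lerDl sumr_ge0// => i _.
exact: sqnorm_ge0.
Qed.

(** A strong induction, because the lower bound at k uses the invertibility
    of all earlier d_j, which in turn follows from their lower bounds. *)
Lemma fbt_coercive l k : A^T = A -> 0 < l ->
    (forall x : 'rV_(\sum_(i < N) n), l * sqnorm x <= qform A x) -> (k < N)%N ->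
  [/\ (fbt b c k)^T = fbt b c k, fbt b c k \in unitmx
    & forall v, l * sqnorm v <= qform (fbt b c k) v].
Proof.
move=> A_sym l_gt0 lA; elim/ltn_ind: k => k IHk ltkN.
have fbt_ge v : l * sqnorm v <= qform (fbt b c k) v.
  apply: qform_fbt_ge => //; first exact: ltW.
  by move=> j ltjk; have [] := IHk j ltjk (ltn_trans ltjk ltkN).
split=> //; last exact: unitmx_coercive fbt_ge.
case: k IHk ltkN {fbt_ge} => [|k] IHk ltkN; first exact: diag_block_sym.
have [fbt_sym _ _] := IHk k (ltnSn k) (ltnW ltkN).
rewrite /= linearB/= diag_block_sym// !trmx_mul trmxK trmx_inv fbt_sym.
by rewrite mulmxA.
Qed.

(** Passing from b_k to d_k subtracts the form of the positive definite
    matrix d_(k-1)^-1 at v c_k, so the form of the diagonal block b_k, which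
    is a restriction of that of A, is an upper bound. *)
Lemma qform_fbt_le l u k v : A^T = A -> 0 < l ->
    (forall x : 'rV_(\sum_(i < N) n), l * sqnorm x <= qform A x) ->
    (forall x : 'rV_(\sum_(i < N) n), qform A x <= u * sqnorm x) -> (k < N)%N ->
  qform (fbt b c k) v <= u * sqnorm v.
Proof.
move=> A_sym l_gt0 lA Au ltkN.
apply: (@le_trans _ _ (qform (b k) v)).
  case: k ltkN => [//|k] ltkN.
  have [fbt_sym fbt_unit fbt_ge] := fbt_coercive l k A_sym l_gt0 lA (ltnW ltkN).
  rewrite /= mulmxBr mulmxBl !mxE lerBlDr lerDl.
  have := qform_invmx_ge0 _ _ (v *m c k.+1) fbt_sym fbt_unit.
  rewrite trmx_mul !mulmxA mxE; apply=> y.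
  by apply: le_trans _ (fbt_ge y); rewrite mulr_ge0 ?sqnorm_ge0// ltW.
by rewrite -qform_diag_block// (le_trans (Au _))// sqnorm_blockv1.
Qed.

End BlockElimination.

(** * Eigenvalue bounds for the iteration *)

Theorem mainTheorem5 (R : realType) (N n : nat) (N_gt0 : (0 < N)%N)
    (n_gt0 : (0 < n)%N) (b c : nat -> 'M[R]_n)
    (A : 'M[R]_(\sum_(i < N) n)) (A_tridiag : A = block_tridiag N b c)
    (A_sym : A^T = A) (alphaL alphaU : R)
    (alphaL_gt0 : 0 < alphaL)
    (alphaL_le : alphaL <= lambda_min A)
    (lambda_le : lambda_min A <= lambda_max A)
    (le_alphaU : lambda_max A <= alphaU) :
  forall k : nat, (k < N)%N ->
    ((fbt b c k)^T = fbt b c k /\ fbt b c k \in unitmx) /\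
    [/\ 0 < alphaL,
        alphaL <= lambda_min (fbt b c k),
        lambda_min (fbt b c k) <= lambda_max (fbt b c k) &
        lambda_max (fbt b c k) <= alphaU].
Proof.
subst A; have A_size : (0 < \sum_(i < N) n)%N.
  by rewrite sum_nat_const card_ord muln_gt0 N_gt0.
have A_ge (x : 'rV_(\sum_(i < N) n)) :
    alphaL * sqnorm x <= qform (block_tridiag N b c) x.
  apply: (le_trans _ (qform_ge_lambda_min _ _ A_size A_sym x)).
  by rewrite ler_wpM2r ?sqnorm_ge0.
have A_le (x : 'rV_(\sum_(i < N) n)) :
    qform (block_tridiag N b c) x <= alphaU * sqnorm x.
  apply: (le_trans (qform_le_lambda_max _ _ A_size A_sym x)).
  by rewrite ler_wpM2r ?sqnorm_ge0.
move=> k ltkN.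
have [fbt_sym fbt_unit fbt_ge] :=
  fbt_coercive N b c alphaL k A_sym alphaL_gt0 A_ge ltkN.
have fbt_le (v : 'rV_n) : qform (fbt b c k) v <= alphaU * sqnorm v.
  exact: qform_fbt_le A_sym alphaL_gt0 A_ge A_le ltkN.
by have [] := lambda_bounds _ _ n_gt0 fbt_sym alphaL alphaU fbt_ge fbt_le.
Qed.
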